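(* Let $U\subset\mathbb{R}^2$ be open, let $X:U\to\mathbb{R}^3$ be a regular parametrization of a nondegenerate surface $\Sigma=X(U)$, and let $\alpha:I\to\mathbb{R}^3$ be a regular, nondegenerate curve contained in $\Sigma$. Then $\alpha$ is a commensurate curve if and only if, for all $t\in I$, $$\det\left[\alpha'(t)\ \ \alpha''(t)\ \ \alpha'''(t)\right]=\left[\mathrm{I}_{\mathrm{aff}}(\alpha'(t))\right]^3 .$$
   Context: All maps are smooth ($C^\infty$). $I\subset\mathbb{R}$ is an interval containing $0$. A regular parametrization $X:U\to\mathbb{R}^3$, $(u,v)\mapsto X(u,v)$, is a smooth immersion that is a homeomorphism onto its image $\Sigma$. Subscripts denote partial derivatives. $\det[a\ \ b\ \ c]$ is the determinant of the $3\times 3$ matrix with columns $a,b,c$. Surfaces. Put $\ell=\det[X_u\ X_v\ X_{uu}]$, $m=\det[X_u\ X_v\ X_{uv}]$, $n=\det[X_u\ X_v\ X_{vv}]$. The surface is nondegenerate if $\ell n-m^2\neq 0$ everywhere on $U$. Its affine first fundamental form is the quadratic form on tangent vectors $\mathrm{I}_{\mathrm{aff}}=|\ell n-m^2|^{-1/4}(\ell\,du^2+2m\,du\,dv+n\,dv^2)$, i.e. $\mathrm{I}_{\mathrm{aff}}(aX_u+bX_v)=|\ell n-m^2|^{-1/4}(\ell a^2+2mab+nb^2)$ at the given point. Curves. A curve $\alpha$ is regular if $\alpha'(t)\ne 0$ for all $t$, and nondegenerate if $\alpha'(t),\alpha''(t),\alpha'''(t)$ are linearly independent for every $t\in I$.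 Standing assumption: $\det[\alpha'(t)\ \alpha''(t)\ \alpha'''(t)]>0$ for all $t \in I$. The affine arc length function of a nondegenerate curve is $s_\alpha(t)=\int_0^t\sqrt[6]{\det[\alpha'(\sigma)\ \alpha''(\sigma)\ \alpha'''(\sigma)]}\,d\sigma$. A curve contained in $\Sigma$ can be written $\alpha(t)=X(u(t),v(t))$ with $u,v$ smooth. The induced arc length function is $s_\Sigma(t)=\int_0^t\sqrt{\mathrm{I}_{\mathrm{aff}}(\alpha'(\sigma))}\,d\sigma$, defined when $\mathrm{I}_{\mathrm{aff}}(\alpha'(t))\ge 0$ for all $t\in I$. A nondegenerate curve $\alpha$ contained in a nondegenerate surface $\Sigma$ is commensurate if $s_\Sigma$ is defined and $s_\alpha(t)=s_\Sigma(t)$ for all $t\in I$. *)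

(* Defs.v *)
From HB Require Import structures.
From mathcomp Require Import all_boot all_order all_algebra.
From mathcomp Require Import all_classical all_reals all_analysis.

Set Implicit Arguments.
Unset Strict Implicit.
Unset Printing Implicit Defensive.

Import Order.TTheory GRing.Theory Num.Theory.
Import numFieldNormedType.Exports.

Local Open Scope classical_set_scope.
Local Open Scope ring_scope.

Section Smooth.
Context {R : realType} {V W : normedModType R}.

(* For A open and V finite-dimensional this is the usual class C^k: f is
   C^(k+1) iff it is differentiable and all its directional derivatives are
   C^k. *)
Fixpoint Ck_on (A : set V) (k : nat) (f : V -> W) : Prop :=
  match k with
  | 0 => forall x, A x -> {for x, continuous f}
  | k'.+1 => (forall x, A x -> differentiable f x) /\
             (forall v, Ck_on A k' (fun x => 'D_v f x))
  end.

Definition smooth_on (A : set V) (f : V -> W) := forall k, Ck_on A k f.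

End Smooth.

Section Affine.
Context {R : realType}.
Implicit Types (U : set (R * R)%type) (X : (R * R)%type -> 'cV[R]_3).
Implicit Types (p c : (R * R)%type) (q w : 'cV[R]_3).
Implicit Types (I : set R) (alpha : R -> 'cV[R]_3).

Definition det3 (a b c : 'cV[R]_3) : R :=
  \det (row_mx a (row_mx b c) : 'M[R]_3).

Definition du X p : 'cV[R]_3 := 'D_((1, 0) : (R * R)%type) X p.
Definition dv X p : 'cV[R]_3 := 'D_((0, 1) : (R * R)%type) X p.

Definition immersion U X := forall p, U p -> injective ('d X p).

Definition homeo_onto_image U X :=
  {within U, continuous X} /\
  exists g : 'cV[R]_3 -> (R * R)%type,
    (forall p, U p -> g (X p) = p) /\ {within X @` U, continuous g}.

Definition regular_parametrization U X :=
  [/\ smooth_on U X, immersion U X & homeo_onto_image U X].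

Definition surf_l X p := det3 (du X p) (dv X p) (du (du X) p).
Definition surf_m X p := det3 (du X p) (dv X p) (dv (du X) p).
Definition surf_n X p := det3 (du X p) (dv X p) (dv (dv X) p).

Definition surf_disc X p := surf_l X p * surf_n X p - surf_m X p ^+ 2.

Definition nondegenerate_surface U X := forall p, U p -> surf_disc X p != 0.

Definition Iaff_coord X p (a b : R) : R :=
  `|surf_disc X p| `^ (- (4%:R)^-1) *
  (surf_l X p * a ^+ 2 + 2%:R * surf_m X p * a * b + surf_n X p * b ^+ 2).

(* Both choices are unique for a regular parametrization, q on the surface and
   w tangent at q (see IaffE); elsewhere the value is irrelevant. *)
Definition param_point U X q : (R * R)%type :=
  xget (0, 0) [set p | U p /\ X p = q].

Definition tangent_coord X p w : (R * R)%type :=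
  xget (0, 0) [set c | w = c.1 *: du X p + c.2 *: dv X p].

Definition Iaff U X q w : R :=
  let p := param_point U X q in
  let c := tangent_coord X p w in
  Iaff_coord X p c.1 c.2.

Lemma IaffE U X p (a b : R) : regular_parametrization U X -> U p ->
  Iaff U X (X p) (a *: du X p + b *: dv X p) = Iaff_coord X p a b.
Proof.
move=> [smX immX [_ [g [gX _]]]] Up.
have dX : differentiable X p by have [+ _] := smX 1%N; apply.
have dXE c : c.1 *: du X p + c.2 *: dv X p = 'd X p c.
  rewrite /du /dv !deriveE// -!linearZ -linearD; congr ('d X p _).
  case: c => c1 c2; rewrite /GRing.scale/= /GRing.add/=; congr pair.
    by rewrite /= scaler0 addr0 [LHS]mulr1.
  by rewrite /= scaler0 add0r [LHS]mulr1.
have -> : Iaff U X (X p) (a *: du X p + b *: dv X p) =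
  let c := tangent_coord X p (a *: du X p + b *: dv X p) in
  Iaff_coord X p c.1 c.2.
  rewrite /Iaff; suff -> : param_point U X (X p) = p by [].
  rewrite /param_point; case: xgetP => [p' _ [Up' Xp']|/(_ p)[]//].
  by rewrite -(gX _ Up') Xp' gX.
suff -> : tangent_coord X p (a *: du X p + b *: dv X p) = (a, b) by [].
rewrite /tangent_coord; case: xgetP => [c _ /= cE|/(_ (a, b))[]//].
by apply: (immX _ Up); rewrite -!dXE.
Qed.

(* I need not be open: a map is smooth on I when it extends smoothly to an open
   set J containing I. The derivatives of alpha at points of a nontrivial
   interval I do not depend on the extension. *)
Definition smooth_curve I alpha :=
  exists J : set R, [/\ open J, I `<=` J & smooth_on J alpha].

Definition regular_curve I alpha := forall t, I t -> alpha^`()%classic t != 0.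

Definition nondegenerate_curve I alpha := forall t, I t ->
  free [:: alpha^`()%classic t; alpha^`(2)%classic t; alpha^`(3)%classic t].

Definition curve_det alpha (t : R) : R :=
  det3 (alpha^`()%classic t) (alpha^`(2)%classic t) (alpha^`(3)%classic t).

Definition oriented_integral (f : R -> R) (t : R) : R :=
  if 0 <= t then (\int[lebesgue_measure]_(x in `[0, t]) f x)%R
  else - (\int[lebesgue_measure]_(x in `[t, 0]) f x)%R.

Definition affine_arclength alpha (t : R) : R :=
  oriented_integral (fun s => curve_det alpha s `^ (6%:R)^-1) t.

Definition induced_arclength U X alpha (t : R) : R :=
  oriented_integral (fun s => Num.sqrt (Iaff U X (alpha s) (alpha^`()%classic s))) t.

Definition commensurate U X I alpha :=
  (forall t, I t -> 0 <= Iaff U X (alpha t) (alpha^`()%classic t)) /\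
  (forall t, I t -> affine_arclength alpha t = induced_arclength U X alpha t).

End Affine.

(* Main.v *)
(* A continuous lift p of the curve to U makes its velocity tangent: X being an
   immersion, the increments of p are bounded by those of alpha, so that the
   first order expansion of X at p(t) puts alpha'(t) in the range of dX. Its
   coordinates are those of an orthogonal projection, hence continuous, and so
   is t |-> I_aff(alpha'(t)) on I. Both arc length integrands being continuous,
   differentiating s_alpha = s_Sigma gives det^(1/6) = sqrt(I_aff), that is,
   det = I_aff^3; conversely this identity equates the integrands, with
   I_aff > 0 because det > 0. *)

Require Import Defs.
From HB Require Import structures.
From mathcomp Require Import all_boot all_order all_algebra.
From mathcomp Require Import ring lra.
From mathcomp Require Import all_classical all_reals all_analysis.

Set Implicit Arguments.
Unset Strict Implicit.
Unset Printing Implicit Defensive.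

Import Order.TTheory GRing.Theory Num.Theory.
Import numFieldNormedType.Exports.
Local Open Scope classical_set_scope.
Local Open Scope ring_scope.

(** * Recovering continuous integrands from their integrals *)

(** At interior points the fundamental theorem of calculus applies, since the two integrals agree on
    a neighbourhood and so have the same derivative. The endpoint values are one-sided limits of the
    interior ones. *)
Lemma eq_of_Rintegral (R : realType) (f g : R -> R) (a b : R) : a < b ->
  {within `[a, b], continuous f} -> {within `[a, b], continuous g} ->
  (forall x, a <= x <= b ->
    (\int[lebesgue_measure]_(t in `[a, x]) f t)%R =
    (\int[lebesgue_measure]_(t in `[a, x]) g t)%R) ->
  forall x, a <= x <= b -> f x = g x.
Proof.
move=> ab cf cg fg.
have [fo fa fb] := (continuous_within_itvP f ab).1 cf.
have [go ga gb] := (continuous_within_itvP g ab).1 cg.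
have integrab h : {within `[a, b], continuous h} ->
    lebesgue_measure.-integrable `[a, b] (EFin \o h).
  by move=> ch; apply: continuous_compact_integrable ch; exact: segment_compact.
have fgo x : x \in `]a, b[ -> f x = g x.
  move=> xab; have /andP[ax xb] : a < x < b by rewrite in_itv in xab.
  have [_ <-] := continuous_FTC1_closed xb (integrab _ cf) ax (fo _ xab).
  have [_ <-] := continuous_FTC1_closed xb (integrab _ cg) ax (go _ xab).
  rewrite !derive1E; apply: near_eq_derive; near=> y.
  have : y \in `]a, b[ by near: y; exact: near_in_itvoo.
  by rewrite in_itv/= => /andP[ay yb]; apply: fg; rewrite !ltW.
move=> x; rewrite !le_eqVlt => /andP[/predU1P[<-{x} _|ax /predU1P[->|xb]]].
- apply: (@cvg_unique _ (@Rhausdorff R) (f @ a^'+)) => //.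
  apply: cvg_trans ga; apply: near_eq_cvg; near=> y.
  by apply/esym/fgo; rewrite in_itv/=; apply/andP; split.
- apply: (@cvg_unique _ (@Rhausdorff R) (f @ b^'-)) => //.
  apply: cvg_trans gb; apply: near_eq_cvg; near=> y.
  by apply/esym/fgo; rewrite in_itv/=; apply/andP; split.
- by apply: fgo; rewrite in_itv/= ax xb.
Unshelve. all: by end_near. Qed.

Lemma eq_oriented_integral (R : realType) (I : set R) (f g : R -> R) (t : R) :
  is_interval I -> I 0 -> I t -> {in I, f =1 g} ->
  oriented_integral f t = oriented_integral g t.
Proof.
move=> itvI I0 It fg; rewrite /oriented_integral; case: ifPn => t0.
  apply: eq_Rintegral => x; rewrite inE/= in_itv/= => xt.
  by apply: fg; rewrite inE; exact: itvI xt.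
congr (- _); apply: eq_Rintegral => x; rewrite inE/= in_itv/= => xt.
by apply: fg; rewrite inE; exact: itvI xt.
Qed.

(** Reduces to [eq_of_Rintegral] on the segment between 0 and a nonzero point of [I]. The value at 0
    itself is read off from the segment ending at [t0]. *)
Lemma eq_of_oriented_integral (R : realType) (I : set R) (f g : R -> R) :
  is_interval I -> I 0 -> (exists2 t, I t & t != 0) ->
  {within I, continuous f} -> {within I, continuous g} ->
  (forall t, I t -> oriented_integral f t = oriented_integral g t) ->
  forall t, I t -> f t = g t.
Proof.
move=> itvI I0 [t0 It0 t0_neq0] cf cg fg.
suff neq0 t : I t -> t != 0 -> forall x, Num.min 0 t <= x <= Num.max 0 t -> f x = g x.
  move=> t It; have [->|tn0] := eqVneq t 0; last first.
    by apply: (neq0 _ It) => //; rewrite ge_min le_max lexx !orbT.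
  by apply: (neq0 _ It0) => //; rewrite ge_min le_max lexx.
move=> It; rewrite neq_lt => /orP[] lt0t.
- rewrite min_r ?max_l ?(ltW lt0t)//.
  have sub : `[t, 0] `<=` I by move=> y /=; rewrite in_itv/=; exact: itvI.
  have cft := continuous_subspaceW sub cf; have cgt := continuous_subspaceW sub cg.
  have integr h : {within `[t, 0], continuous h} ->
      lebesgue_measure.-integrable `[t, 0] (EFin \o h).
    by move=> ch; apply: continuous_compact_integrable ch; exact: segment_compact.
  (* For negative [x] the moving bound is the lower one, whereas [eq_of_Rintegral] moves the upper
     one: [tail] states what the hypothesis gives, and [head] passes to the complement in
     [[t, 0]]. *)
  have tail x : t <= x <= 0 ->
      \int[lebesgue_measure]_(y in `[x, 0]) f y =
      \int[lebesgue_measure]_(y in `[x, 0]) g y.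
    (* At [x = 0] the function [oriented_integral] is in its nonnegative branch, so this case is
       separate: both integrals are over a point. *)
    move=> /andP[tx]; rewrite le_eqVlt => /predU1P[->|x0].
      by rewrite set_itv1 !Rintegral_set1.
    have /fg : I x by apply: sub; rewrite /= in_itv/= tx ltW.
    by rewrite /oriented_integral leNgt x0 => /oppr_inj.
  have head h x : {within `[t, 0], continuous h} -> t <= x <= 0 ->
      \int[lebesgue_measure]_(y in `[t, x]) h y =
      \int[lebesgue_measure]_(y in `[t, 0]) h y -
      \int[lebesgue_measure]_(y in `[x, 0]) h y.
    move=> ch /andP[tx x0]; have := @Rintegral_itvB _ h _ _ x (integr _ ch).
    rewrite !bnd_simp => /(_ tx x0) => /eqP; rewrite subr_eq => /eqP ->.
    (* The subtraction leaves the interval open at [x]; adding that point does not change the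
       integral. *)
    rewrite Rintegral_itv_obnd_cbnd; first by rewrite addrAC subrr add0r.
    apply: integrableS (integr _ ch) => //.
    by apply: subset_itvr; rewrite bnd_simp.
  apply: eq_of_Rintegral => // x tx; rewrite (head f x)// (head g x)//.
  by rewrite !tail// lexx ltW.
- rewrite min_l ?max_r ?(ltW lt0t)//.
  have sub : `[0, t] `<=` I by move=> y /=; rewrite in_itv/=; exact: itvI.
  apply: eq_of_Rintegral => //; [exact: continuous_subspaceW cf|
    exact: continuous_subspaceW cg|move=> x /andP[x0 xt]].
  have /fg : I x by apply: sub; rewrite /= in_itv/= x0.
  by rewrite /oriented_integral x0.
Qed.

(** * Limits of powers and determinants *)

(** A positive limit keeps [f] eventually positive, where the power is [expR (r * ln f)]; [r] may
    thus be negative, as for the exponent -1/4 of the affine form. *)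
Lemma cvg_powR (R : realType) (T : Type) (F : set_system T) {FF : Filter F}
    (f : T -> R) (a r : R) : 0 < a ->
  f @ F --> a -> f x `^ r @[x --> F] --> a `^ r.
Proof.
move=> a0 fa.
have -> : a `^ r = expR (r * ln a) by rewrite /powR gt_eqF.
apply: cvg_trans (_ : expR (r * ln (f x)) @[x --> F] --> _).
  apply: near_eq_cvg; near=> x; rewrite /powR gt_eqF//; near: x.
  exact: (cvgr_gt a).
apply: continuous_cvg; first exact: continuous_expR.
apply: cvgM; first exact: cvg_cst.
by apply: continuous_cvg => //; exact: continuous_ln.
Unshelve. all: by end_near. Qed.

Lemma cvg_coord (R : realType) (T : Type) (F : set_system T) {FF : Filter F}
    (m n : nat) (A : T -> 'M[R]_(m, n)) (A0 : 'M[R]_(m, n)) i j :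
  A @ F --> A0 -> A x i j @[x --> F] --> A0 i j.
Proof.
move=> AA0; apply: (cvg_comp A (fun M : 'M[R]_(m, n) => M i j) AA0).
exact: coord_continuous.
Qed.

(** The Leibniz expansion is polynomial in the entries. Convergence is assumed entrywise so that
    block rows can be treated by [cvg_row_mx]. *)
Lemma cvg_det (R : realType) (T : Type) (F : set_system T) {FF : Filter F}
    (n : nat) (A : T -> 'M[R]_n) (A0 : 'M[R]_n) :
  (forall i j, A x i j @[x --> F] --> A0 i j) ->
  \det (A x) @[x --> F] --> \det A0.
Proof.
move=> AA0; apply: cvg_big => [|s _]; first exact: add_continuous.
apply: cvgM; first exact: cvg_cst.
by apply: cvg_big => [|i _]; [exact: mul_continuous|exact: AA0].
Qed.

Lemma cvg_row_mx (R : realType) (T : Type) (F : set_system T) {FF : Filter F}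
    (m n1 n2 : nat) (A : T -> 'M[R]_(m, n1)) (B : T -> 'M[R]_(m, n2))
    (A0 : 'M[R]_(m, n1)) (B0 : 'M[R]_(m, n2)) :
  (forall i j, A x i j @[x --> F] --> A0 i j) ->
  (forall i j, B x i j @[x --> F] --> B0 i j) ->
  forall i j, row_mx (A x) (B x) i j @[x --> F] --> row_mx A0 B0 i j.
Proof.
move=> AA0 BB0 i j; case: (split_ordP j) => k ->.
  by rewrite row_mxEl; under eq_cvg do rewrite row_mxEl; exact: AA0.
by rewrite row_mxEr; under eq_cvg do rewrite row_mxEr; exact: BB0.
Qed.

Lemma cvg_det3 (R : realType) (T : Type) (F : set_system T) {FF : Filter F}
    (a b c : T -> 'cV[R]_3) (a0 b0 c0 : 'cV[R]_3) :
  a @ F --> a0 -> b @ F --> b0 -> c @ F --> c0 ->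
  det3 (a x) (b x) (c x) @[x --> F] --> det3 a0 b0 c0.
Proof.
move=> aa0 bb0 cc0; apply: cvg_det => i j.
apply: cvg_row_mx => {}i {}j; first exact: cvg_coord.
by apply: cvg_row_mx => {}i {}j; exact: cvg_coord.
Qed.

(** * Euclidean projection onto the plane of two vectors *)

Definition dot (R : realType) (a b : 'cV[R]_3) : R := \sum_i a i 0 * b i 0.

Lemma dotC (R : realType) (a b : 'cV[R]_3) : dot a b = dot b a.
Proof. by apply: eq_bigr => i _; rewrite mulrC. Qed.

Lemma dotDr (R : realType) (a b c : 'cV[R]_3) : dot a (b + c) = dot a b + dot a c.
Proof. by rewrite -big_split; apply: eq_bigr => i _; rewrite mxE mulrDr. Qed.

Lemma dotZr (R : realType) (k : R) (a b : 'cV[R]_3) : dot a (k *: b) = k * dot a b.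
Proof. by rewrite mulr_sumr; apply: eq_bigr => i _; rewrite mxE mulrCA. Qed.

Lemma dot_eq0 (R : realType) (a : 'cV[R]_3) : (dot a a == 0) = (a == 0).
Proof.
rewrite /dot; apply/idP/eqP => [|->]; last by rewrite big1// => i _; rewrite mxE mul0r.
rewrite psumr_eq0; last by move=> i _; rewrite -expr2 sqr_ge0.
move=> /allP a0; apply/matrixP => i j; rewrite ord1 mxE; apply/eqP.
by have := a0 i; rewrite mem_index_enum mulf_eq0 orbb => /(_ isT).
Qed.

Lemma cvg_dot (R : realType) (T : Type) (F : set_system T) {FF : Filter F}
    (a b : T -> 'cV[R]_3) (a0 b0 : 'cV[R]_3) :
  a @ F --> a0 -> b @ F --> b0 -> dot (a x) (b x) @[x --> F] --> dot a0 b0.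
Proof.
move=> aa0 bb0; apply: cvg_big => [|i _]; first exact: add_continuous.
by apply: cvgM; exact: cvg_coord.
Qed.

(** The Gram determinant, that is, the squared area of the parallelogram on [a] and [b]. *)
Definition gram (R : realType) (a b : 'cV[R]_3) : R :=
  dot a a * dot b b - dot a b ^+ 2.

(* The coordinates in the basis [a, b] of the orthogonal projection of [w] on
   the plane they span (Cramer's rule for the normal equations). *)
Definition proj_coord (R : realType) (a b w : 'cV[R]_3) : (R * R)%type :=
  ((dot b b * dot a w - dot a b * dot b w) / gram a b,
   (dot a a * dot b w - dot a b * dot a w) / gram a b).

Lemma proj_coord_linear (R : realType) (a b : 'cV[R]_3) : linear (proj_coord a b).
Proof.
move=> k u v.
have pairE (x y z t : R) :
  k *: ((x, y) : R * R) + ((z, t) : R * R) = (k * x + z, k * y + t) by [].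
rewrite /proj_coord pairE !dotDr !dotZr.
by congr pair; rewrite mulrA -mulrDl; congr (_ / _); ring.
Qed.

HB.instance Definition _ (R : realType) (a b : 'cV[R]_3) :=
  @GRing.isLinear.Build R 'cV[R]_3 (R * R)%type _ (proj_coord a b)
    (proj_coord_linear a b).

(** Applied to [du X p] and [dv X p], this gives a linear left inverse of the differential of [X] at
    [p]. *)
Lemma proj_coordK (R : realType) (a b : 'cV[R]_3) (c : (R * R)%type) :
  gram a b != 0 -> proj_coord a b (c.1 *: a + c.2 *: b) = c.
Proof.
case: c => c1 c2 /= g0; rewrite /proj_coord !dotDr !dotZr (dotC b a).
by congr pair; rewrite /gram; field.
Qed.

(** The combination of [a] and [b] with coefficients [- dot a b] and [dot a a] has squared length
    [dot a a * gram a b]. If the Gram determinant vanished, it would be a linear relation with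
    nonzero coefficient [dot a a]. *)
Lemma gram_neq0 (R : realType) (a b : 'cV[R]_3) :
  (forall c : (R * R)%type, c.1 *: a + c.2 *: b = 0 -> c = 0) -> gram a b != 0.
Proof.
move=> indep; apply/eqP => g0.
have a0 : a != 0.
  apply/eqP => a0; have := indep (1, 0).
  by rewrite a0 scaler0 scale0r addr0 => /(_ erefl)[/eqP]; rewrite oner_eq0.
have : dot (- dot a b *: a + dot a a *: b) (- dot a b *: a + dot a a *: b) == 0.
  rewrite dotDr !dotZr ![dot (_ + _) _]dotC !dotDr !dotZr (dotC b a).
  by rewrite -[X in _ == X](mulr0 (dot a a)) -g0 /gram; apply/eqP; ring.
rewrite dot_eq0 => /eqP /(indep (- dot a b, dot a a))[_ /eqP].
by rewrite dot_eq0 (negbTE a0).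
Qed.

(** All three arguments vary because the tangent basis moves along the curve together with the
    velocity. *)
Lemma cvg_proj_coord (R : realType) (T : Type) (F : set_system T)
    {FF : Filter F} (a b w : T -> 'cV[R]_3) (a0 b0 w0 : 'cV[R]_3) :
  gram a0 b0 != 0 -> a @ F --> a0 -> b @ F --> b0 -> w @ F --> w0 ->
  proj_coord (a x) (b x) (w x) @[x --> F] --> proj_coord a0 b0 w0.
Proof.
move=> g0 aa bb ww.
have cg : gram (a x) (b x) @[x --> F] --> gram a0 b0.
  apply: cvgB; first by apply: cvgM; exact: cvg_dot.
  by rewrite expr2; under eq_cvg do rewrite expr2; apply: cvgM; exact: cvg_dot.
apply: (@cvg_pair _ _ _ F (nbhs _) (nbhs _)); apply: cvgM; try exact: cvgV.
  by apply: cvgB; apply: cvgM; exact: cvg_dot.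
by apply: cvgB; apply: cvgM; exact: cvg_dot.
Qed.

Lemma proj_coord_continuous (R : realType) (a b : 'cV[R]_3) :
  gram a b != 0 -> continuous (proj_coord a b).
Proof.
move=> g0 w.
apply: (@cvg_proj_coord R _ (nbhs w) _ (cst a) (cst b) id a b w g0).
- exact: cvg_cst.
- exact: cvg_cst.
- exact: cvg_id.
Qed.

(** * Velocity of a curve that factors through a differentiable map *)

Lemma diff_approx (R : realType) (V W : normedModType R) (f : V -> W) (x : V)
    (e : R) : differentiable f x -> 0 < e ->
  \forall y \near x, `|f y - f x - 'd f x (y - x)| <= e * `|y - x|.
Proof.
move=> /diff_locallyP[_ /eqaddoP fo] e0; rewrite (near_shift 0 x) subr0.
have := fo _ e0; apply: filterS => h.
by rewrite !fctE/= addrK opprD addrA.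
Qed.

(** All points between [t] and [t1] belong to [I], so a one-sided approach to [t] from the side of
    [t1] stays in [I]. *)
Lemma interval_adherent (R : realType) (I : set R) (t t1 : R) (A : set R) :
  is_interval I -> I t -> I t1 -> t1 != t -> (\forall s \near t, A s) ->
  exists s, [/\ I s, s != t & A s].
Proof.
move=> itvI It It1; rewrite neq_lt => /orP[tt1|tt1] At.
- near t^'- => s; exists s; split; last by near: s; exact: cvg_within.
    by apply: (itvI _ _ It1 It); rewrite !ltW.
  by rewrite lt_eqF.
- near t^'+ => s; exists s; split; last by near: s; exact: cvg_within.
    by apply: (itvI _ _ It It1); rewrite !ltW.
  by rewrite gt_eqF.
Unshelve. all: by end_near. Qed.

(* The curve is only known to factor through [f] by a continuous [p]: the left
   inverse [L] of the differential bounds the increments of [p] by those of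
   [c], so that the remainder in the expansion of [f] is negligible. *)
Lemma tangent_of_factor (R : realType) (V W : normedModType R) (f : V -> W)
    (c : R -> W) (p : R -> V) (L : {linear W -> V}) (I : set R) (t t1 : R) :
  is_interval I -> I t -> I t1 -> t1 != t ->
  differentiable f (p t) -> differentiable c t ->
  continuous L -> cancel ('d f (p t)) L ->
  p @ within I (nbhs t) --> p t -> (forall s, I s -> c s = f (p s)) ->
  'd f (p t) (L (c^`()%classic t)) = c^`()%classic t.
Proof.
move=> itvI It It1 t1t df dc cL dfK cp cE.
have bounded (V' W' : normedModType R) (g : {linear V' -> W'}) : continuous g ->
    exists2 M : R, 0 < M & forall x, `|g x| <= M * `|x|.
  move=> /linear_bounded_continuous/linear_boundedP.
  by move=> /pinfty_ex_gt0 [M M0 gM]; exists M.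
have [K K0 LK] := bounded _ _ _ cL.
have [M M0 dM] := bounded _ _ _ (diff_continuous df).
(* [N] is linear and kills the range of ['d f (p t)], as [Nd] records; the goal amounts to
   [N w = 0]. *)
set w := c^`()%classic t; set N := fun x => x - 'd f (p t) (L x).
have NB x y : N (x - y) = N x - N y.
  rewrite /N (linearB L) (linearB ('d f (p t))) !opprB [LHS]addrACA [RHS]addrACA.
  by congr (_ + _); exact: addrC.
have NZ k x : N (k *: x) = k *: N x by rewrite /N (linearZZ L) (linearZZ ('d f (p t))) scalerBr.
have NM x : `|N x| <= (1 + M * K) * `|x|.
  rewrite (le_trans (ler_normB _ _))// mulrDl mul1r lerD2l -mulrA.
  by rewrite (le_trans (dM _))// ler_wpM2l// ltW.
have Nd v : N ('d f (p t) v) = 0 by rewrite /N dfK subrr.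
pose B := 1 + M * K; have B0 : 0 < B by rewrite addr_gt0// mulr_gt0.
(* [B] bounds the norm of [N]. The first summand of [C] combines the later bounds [Nr], [PD] and
   [Dh] on [N D], [P] and [D]; the second comes from the remainder of [c]. *)
pose C := B * (2 * K * (`|w| + 1)) + B.
(* Letting [e] tend to 0 gives [N w = 0]. The bound [e <= 1] serves to control [D], and
   [K * e <= 2^-1] to absorb the remainder of [f]. *)
suff small e : 0 < e -> e <= 1 -> K * e <= 2^-1 -> `|N w| <= e * C.
  apply/esym/eqP; rewrite -subr_eq0 -normr_eq0 -/(N w) eq_le normr_ge0 andbT.
  rewrite leNgt; apply/negP => Nw0.
  have C0 : 0 < C by rewrite addr_gt0// !mulr_gt0// ltr_wpDl.
  near (0 : R)^'+ => e.
  suff : `|N w| < `|N w| by rewrite ltxx.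
  apply: (@le_lt_trans _ _ (e * C)).
    apply: small => //; first by near: e; exact: nbhs_right_le.
    rewrite mulrC -ler_pdivlMr//; near: e; apply: nbhs_right_le.
    by rewrite divr_gt0.
  rewrite -ltr_pdivlMr//; near: e; apply: nbhs_right_lt.
  by rewrite divr_gt0.
move=> e0 e1 Ke.
have dw h : 'd c t h = h *: w.
  by rewrite /w derive1E' // -linearZ/= [_ *: _]mulr1.
(* One point [s] of [I] where both first order expansions hold. That of [f] is only required for [s]
   in [I], since [p] is continuous along [I] only. *)
have [] := @interval_adherent R I t t1 (fun s =>
    `|c s - c t - 'd c t (s - t)| <= e * `|s - t| /\
    (I s -> `|f (p s) - f (p t) - 'd f (p t) (p s - p t)| <= e * `|p s - p t|))
    itvI It It1 t1t.
  apply: filterI; first exact: (diff_approx dc e0).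
  exact: (cp _ (diff_approx df e0)).
move=> s [Is st []]; rewrite dw => cs /(_ Is); rewrite -!cE//.
set h := s - t in cs *; set D := c s - c t in cs *; set P := p s - p t.
move=> rP; set r := D - 'd f (p t) P in rP *.
have h0 : 0 < `|h| by rewrite normr_gt0 subr_eq0.
(* Applying [L] to the expansion of [f] gives [P = L D - L r] with [r] at most [e * |P|] in norm;
   the last term is at most half of [|P|] and moves to the left. *)
have PD : `|P| <= 2 * K * `|D|.
  have : `|P| <= K * `|D| + K * (e * `|P|).
    have -> : P = L D - L r by rewrite -linearB /r subKr dfK.
    rewrite (le_trans (ler_normB _ _))// lerD//.
    rewrite (le_trans (LK _))// ler_wpM2l ?(ltW K0)//.
    rewrite (le_trans rP)//.
    by rewrite -linearB /r subKr dfK.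
  have : K * e * `|P| <= 2^-1 * `|P| by rewrite ler_wpM2r.
  by rewrite mulrA; lra.
have Dh : `|D| <= (`|w| + 1) * `|h|.
  rewrite -[D](subrK (h *: w)) (le_trans (ler_normD _ _))//.
  rewrite normrZ mulrDl addrC mulrC lerD2l.
  by rewrite (le_trans cs)// ler_wpM2r.
have Nr : `|N D| <= B * (e * `|P|).
  have -> : N D = N r by rewrite /r (NB D ('d f (p t) P)) Nd subr0.
  by rewrite (le_trans (NM _))// ler_wpM2l// ltW.
(* After scaling by [h], the vector [h *: w] splits into [D], on which [N] sees only the remainder
   of [f], and the remainder of [c]. *)
rewrite -(ler_pM2l h0) -normrZ -NZ.
have -> : h *: w = D - (D - h *: w) by rewrite subKr.
rewrite (NB D) (le_trans (ler_normB _ _))//.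
have -> : `|h| * (e * C) = B * (e * (2 * K * ((`|w| + 1) * `|h|))) + B * (e * `|h|).
  by rewrite /C; ring.
apply: lerD.
  rewrite (le_trans Nr)// ler_wpM2l ?(ltW B0)// ler_wpM2l ?(ltW e0)//.
  by rewrite (le_trans PD)// ler_wpM2l// mulr_ge0// ltW.
by rewrite (le_trans (NM _))// ler_wpM2l// ltW.
Unshelve. all: by end_near. Qed.

(** * Smooth maps and continuity of the affine form *)

Lemma smooth_on_derive (R : realType) (V W : normedModType R) (A : set V)
    (f : V -> W) (v : V) : smooth_on A f -> smooth_on A (fun x => 'D_v f x).
Proof. by move=> sf k; have [_] := sf k.+1; apply. Qed.

Lemma smooth_on_continuous (R : realType) (V W : normedModType R) (A : set V)
    (f : V -> W) x : smooth_on A f -> A x -> {for x, continuous f}.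
Proof. by move=> /(_ 0%N); apply. Qed.

Lemma smooth_on_differentiable (R : realType) (V W : normedModType R)
    (A : set V) (f : V -> W) x : smooth_on A f -> A x -> differentiable f x.
Proof. by move=> /(_ 1%N)[+ _]; apply. Qed.

Lemma smooth_on_derive1n (R : realType) (W : normedModType R) (A : set R)
    (f : R -> W) n : smooth_on A f -> smooth_on A (f^`(n)%classic).
Proof.
move=> sf; elim: n => [//|n sn]; rewrite derive1nS.
rewrite (_ : _^`()%classic = fun x => 'D_1 f^`(n)%classic x); last first.
  by apply/funext => x; rewrite derive1E.
exact: smooth_on_derive.
Qed.

Lemma cvg_curve_derive1n (R : realType) (I : set R) (alpha : R -> 'cV[R]_3) n t :
  smooth_curve I alpha -> I t ->
  alpha^`(n)%classic @ within I (nbhs t) --> alpha^`(n)%classic t.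
Proof.
move=> [J [_ IJ sJ]] It; apply: cvg_within_filter.
by apply: (smooth_on_continuous (smooth_on_derive1n n sJ)); exact: IJ.
Qed.

Lemma diff_du_dv (R : realType) (X : (R * R)%type -> 'cV[R]_3) p c :
  differentiable X p -> 'd X p c = c.1 *: du X p + c.2 *: dv X p.
Proof.
move=> dX; rewrite /du /dv !deriveE// -!linearZ -linearD; congr ('d X p _).
case: c => c1 c2; rewrite /GRing.scale/= /GRing.add/=; congr pair.
  by rewrite /= scaler0 addr0; apply/esym/mulr1.
by rewrite /= scaler0 add0r; apply/esym/mulr1.
Qed.

Lemma gram_immersion (R : realType) (U : set (R * R)%type)
    (X : (R * R)%type -> 'cV[R]_3) p :
  smooth_on U X -> immersion U X -> U p -> gram (du X p) (dv X p) != 0.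
Proof.
move=> sX iX Up; apply: gram_neq0 => c.
rewrite -diff_du_dv; last exact: smooth_on_differentiable sX Up.
by rewrite -[RHS](linear0 ('d X p)) => /(iX _ Up).
Qed.

(** Nondegeneracy at [p0] makes the limit of [|surf_disc|] positive, so its power -1/4 converges;
    the other factor is polynomial in the coordinates and in the first and second derivatives of
    [X]. *)
Lemma cvg_Iaff_coord (R : realType) (U : set (R * R)%type)
    (X : (R * R)%type -> 'cV[R]_3) (T : Type) (F : set_system T)
    {FF : Filter F} (p c : T -> (R * R)%type) (p0 c0 : (R * R)%type) :
  smooth_on U X -> U p0 -> surf_disc X p0 != 0 ->
  p @ F --> p0 -> c @ F --> c0 ->
  Iaff_coord X (p x) (c x).1 (c x).2 @[x --> F] --> Iaff_coord X p0 c0.1 c0.2.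
Proof.
move=> sX Up0 disc0 pp0 cc0.
have cX v : 'D_v X (p x) @[x --> F] --> 'D_v X p0.
  apply: (cvg_comp p (fun q => 'D_v X q) pp0).
  exact: (smooth_on_continuous (smooth_on_derive v sX) Up0).
have cXX v w : 'D_w (fun q => 'D_v X q) (p x) @[x --> F] -->
    'D_w (fun q => 'D_v X q) p0.
  apply: (cvg_comp p (fun r => 'D_w (fun q => 'D_v X q) r) pp0).
  exact: (smooth_on_continuous (smooth_on_derive w (smooth_on_derive v sX)) Up0).
have cl : surf_l X (p x) @[x --> F] --> surf_l X p0.
  by apply: cvg_det3; [exact: cX|exact: cX|exact: cXX].
have cm : surf_m X (p x) @[x --> F] --> surf_m X p0.
  by apply: cvg_det3; [exact: cX|exact: cX|exact: cXX].
have cn : surf_n X (p x) @[x --> F] --> surf_n X p0.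
  by apply: cvg_det3; [exact: cX|exact: cX|exact: cXX].
have c1 : (c x).1 @[x --> F] --> c0.1 by apply: (cvg_comp c fst cc0); exact: cvg_fst.
have c2 : (c x).2 @[x --> F] --> c0.2 by apply: (cvg_comp c snd cc0); exact: cvg_snd.
have cX2 (f : T -> R) (l : R) : f @ F --> l -> f x ^+ 2 @[x --> F] --> l ^+ 2.
  by move=> fl; rewrite expr2; under eq_cvg do rewrite expr2; exact: (cvgM fl fl).
have cd : surf_disc X (p x) @[x --> F] --> surf_disc X p0.
  exact: (cvgB (cvgM cl cn) (cX2 _ _ cm)).
apply: cvgM; first by apply: cvg_powR; [rewrite normr_gt0|exact: (cvg_norm cd)].
apply: cvgD; last exact: (cvgM cn (cX2 _ _ c2)).
apply: cvgD; first exact: (cvgM cl (cX2 _ _ c1)).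
exact: (cvgM (cvgM (cvgM (cvg_cst _) cm) c1) c2).
Qed.

Lemma cvg_within_image (S T : topologicalType) (A : set S) (B : set T)
    (f : S -> T) (x : S) (y : T) :
  f @ within A (nbhs x) --> y -> (forall z, A z -> B (f z)) ->
  f @ within A (nbhs x) --> within B (nbhs y).
Proof.
move=> fy fAB C BC.
have h : nbhs x (fun z => A z -> B (f z) -> C (f z)) := fy _ BC.
suff : nbhs x (fun z => A z -> C (f z)) by [].
by apply: filterS h => z h Az; exact: (h Az (fAB _ Az)).
Qed.

(** * Lifting the curve to the parameter domain *)

Section curve_on_surface.
Context (R : realType) (U : set (R * R)%type) (X : (R * R)%type -> 'cV[R]_3).
Context (I : set R) (alpha : R -> 'cV[R]_3).
Hypothesis regX : regular_parametrization U X.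
Hypothesis ndX : nondegenerate_surface U X.
Hypotheses (itvI : is_interval I) (I0 : I 0).
Hypothesis nontrivI : exists2 t, I t & t != 0.
Hypothesis smooth_alpha : smooth_curve I alpha.
Hypothesis alpha_in : forall t, I t -> (X @` U) (alpha t).

(** The lift is [g \o alpha] with [g] the inverse of the parametrization. As [g] is continuous
    within the surface only, the limit of [alpha] must first be refined to the surface. *)
Lemma curve_lift : exists p : R -> (R * R)%type,
  forall t, I t -> [/\ U (p t), alpha t = X (p t) &
                       p @ within I (nbhs t) --> p t].
Proof.
have [_ _ [_ [g [gX cg]]]] := regX.
exists (g \o alpha) => t It; have [q Uq Xq] := alpha_in It.
split; [by rewrite /= -Xq gX|by rewrite /= -Xq gX|].
have /(_ _ (alpha_in It)) cgt := (subspace_continuousP _ _).1 cg.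
apply: (cvg_comp alpha g _ cgt); apply: cvg_within_image => [|s /alpha_in//].
exact: (@cvg_curve_derive1n _ _ _ 0 _ smooth_alpha It).
Qed.

(** An instance of [tangent_of_factor] with [proj_coord] as left inverse; this needs only continuity
    of the lift. *)
Lemma velocity_coord (p : R -> (R * R)%type) t : I t -> U (p t) ->
  p @ within I (nbhs t) --> p t -> (forall s, I s -> alpha s = X (p s)) ->
  let c := proj_coord (du X (p t)) (dv X (p t)) (alpha^`()%classic t) in
  alpha^`()%classic t = c.1 *: du X (p t) + c.2 *: dv X (p t).
Proof.
move=> It Up cp alphaE; have [sX iX _] := regX.
have dX := smooth_on_differentiable sX Up.
have g0 := gram_immersion sX iX Up.
move=> c; rewrite -(diff_du_dv c dX); apply/esym.
have [t1 It1 t1t] : exists2 t1, I t1 & t1 != t.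
  by have [->|t0] := eqVneq t 0; [exact: nontrivI|exists 0 => //; rewrite eq_sym].
have [J [_ IJ sJ]] := smooth_alpha.
apply: (@tangent_of_factor _ _ _ X alpha p (proj_coord (du X (p t)) (dv X (p t)))
  I t t1) => //.
- by apply: smooth_on_differentiable sJ _; exact: IJ.
- exact: proj_coord_continuous.
- by move=> d; rewrite (diff_du_dv d dX); exact: proj_coordK.
Qed.

Lemma within_continuous_Iaff :
  {within I, continuous (fun t => Iaff U X (alpha t) (alpha^`()%classic t))}.
Proof.
have [sX iX _] := regX; have [p pP] := curve_lift.
have alphaE s : I s -> alpha s = X (p s) by case/pP.
pose c t := proj_coord (du X (p t)) (dv X (p t)) (alpha^`()%classic t).
(* [Iaff] is defined through choices, whose continuity is not visible; on [I] it equals an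
   expression in the continuous lift and the projection coordinates. *)
have Iaff_lift t : I t -> Iaff U X (alpha t) (alpha^`()%classic t) =
    Iaff_coord X (p t) (c t).1 (c t).2.
  move=> It; have [Up alphat cp] := pP _ It.
  by rewrite {1}alphat {1}(velocity_coord It Up cp alphaE) IaffE.
apply: (@subspace_eq_continuous _ _ _ (fun t => Iaff_coord X (p t) (c t).1 (c t).2)).
  by move=> t; rewrite inE => It; exact/esym/Iaff_lift.
apply/subspace_continuousP => t It; have [Up _ cp] := pP _ It.
apply: (cvg_Iaff_coord sX) => //; first exact: ndX.
apply: cvg_proj_coord; first exact: gram_immersion sX iX Up.
- apply: (cvg_comp p (du X) cp).
  exact: (smooth_on_continuous (smooth_on_derive _ sX) Up).
- apply: (cvg_comp p (dv X) cp).
  exact: (smooth_on_continuous (smooth_on_derive _ sX) Up).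
- exact: (@cvg_curve_derive1n _ _ _ 1 _ smooth_alpha It).
Qed.

Lemma within_continuous_curve_det : {within I, continuous (curve_det alpha)}.
Proof.
apply/subspace_continuousP => t It.
by apply: cvg_det3; [exact: (@cvg_curve_derive1n _ _ _ 1 _ smooth_alpha It)|
  exact: cvg_curve_derive1n|exact: cvg_curve_derive1n].
Qed.

End curve_on_surface.

(** * From equality of integrands to the determinant identity *)

(** Both sides of the first equation are nonnegative, and taking sixth powers turns them into [d]
    and [a ^+ 3]. *)
Lemma powR_inv6_eq_sqrt (R : realType) (d a : R) : 0 < d -> 0 <= a ->
  (d `^ (6%:R)^-1 = Num.sqrt a) <-> (d = a ^+ 3).
Proof.
move=> d0 a0.
have d6 : (d `^ (6%:R)^-1) ^+ 6 = d.
  by rewrite -powR_mulrn ?powR_ge0// -powRrM mulVf// powRr1// ltW.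
have a6 : Num.sqrt a ^+ 6 = a ^+ 3.
  by rewrite (exprM _ 2 3) sqr_sqrtr.
split=> [E|E]; first by rewrite -d6 E a6.
by apply/eqP; rewrite -(@eqrXn2 _ 6) ?powR_ge0 ?sqrtr_ge0// d6 a6 E.
Qed.

Theorem theorem4p2 (R : realType)
  (U : set (R * R)%type) (X : (R * R)%type -> 'cV[R]_3)
  (I : set R) (alpha : R -> 'cV[R]_3)
  (openU : open U)
  (regX : regular_parametrization U X)
  (ndX : nondegenerate_surface U X)
  (itvI : is_interval I) (I0 : I 0) (nontrivI : exists2 t, I t & t != 0)
  (smooth_alpha : smooth_curve I alpha)
  (reg_alpha : regular_curve I alpha)
  (nd_alpha : nondegenerate_curve I alpha)
  (det_gt0 : forall t, I t ->
     0 < det3 (alpha^`()%classic t) (alpha^`(2)%classic t) (alpha^`(3)%classic t))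
  (alpha_in : forall t, I t -> (X @` U) (alpha t)) :
  commensurate U X I alpha <->
  (forall t, I t -> det3 (alpha^`()%classic t) (alpha^`(2)%classic t) (alpha^`(3)%classic t) =
                    Iaff U X (alpha t) (alpha^`()%classic t) ^+ 3).
Proof.
split=> [[Iaff_ge0 eq_length] t It|detE].
- apply/powR_inv6_eq_sqrt; [exact: det_gt0|exact: Iaff_ge0|].
  apply: (eq_of_oriented_integral itvI I0 nontrivI _ _ eq_length It).
  + apply/subspace_continuousP => s Is; apply: cvg_powR; first exact: det_gt0.
    by have /subspace_continuousP := within_continuous_curve_det smooth_alpha; apply.
  + apply/subspace_continuousP => s Is.
    apply: continuous_cvg; first exact: sqrt_continuous.
    have /subspace_continuousP := within_continuous_Iaff regX ndX itvI I0 nontrivI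
      smooth_alpha alpha_in.
    exact.
(* The cube of [Iaff] is a positive determinant and 3 is odd, so [Iaff] is positive and the induced
   arc length is defined. *)
- have Iaff_ge0 t : I t -> 0 <= Iaff U X (alpha t) (alpha^`()%classic t).
    move=> It; have := det_gt0 _ It; rewrite detE//.
    by rewrite exprn_odd_gt0// => /ltW.
  split=> // t It; apply: (eq_oriented_integral itvI I0 It) => s; rewrite inE => Is.
  by apply/powR_inv6_eq_sqrt; [exact: det_gt0|exact: Iaff_ge0|exact: detE].
Qed.
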